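(* Let $X, Y$ be compact Hausdorff spaces and let $\Phi : Y \to X$ be a continuous surjection. Let $\Phi^* : C(X) \to C(Y)$, $\Phi^*(g) = g \circ \Phi$. The induced inclusion $\Phi^*(C(X)) \subseteq C(Y)$ is an SP-inclusion if and only if for every nonempty open subset $U \subseteq X$, the pre-image $\Phi^{-1}[U] \subseteq Y$ contains a nonempty compact open subset.
   Context: An inclusion of C*-algebras $A \subseteq B$ is called an SP-inclusion if for every nonzero element $a \in A_+$ the hereditary C*-subalgebra $\overline{aBa}$ of $B$ contains a nonzero projection. *)

(* Defs.v *)
From HB Require Import structures.
From mathcomp Require Import all_boot all_order all_algebra.
From mathcomp Require Import all_classical all_reals all_analysis.
From mathcomp Require Import complex ring.

Set Implicit Arguments.
Unset Strict Implicit.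
Unset Printing Implicit Defensive.

Import Order.TTheory GRing.Theory Num.Theory.
Import numFieldNormedType.Exports.

Local Open Scope classical_set_scope.
Local Open Scope complex_scope.
Local Open Scope ring_scope.

(* A C*-algebra, not necessarily unital and possibly zero, over the complex
   numbers R[i].  Norms take values in R[i], where 0 <= z means that z is real
   and nonnegative. *)
HB.mixin Record isCstarAlgebra (R : realType) A of CompleteNormedModule R[i] A := {
  cmul : A -> A -> A;
  cadj : A -> A;
  cmulA : associative cmul;
  cmulDl : left_distributive cmul +%R;
  cmulDr : right_distributive cmul +%R;
  cmulZl : forall (l : R[i]) (a b : A), cmul (l *: a) b = l *: cmul a b;
  cmulZr : forall (l : R[i]) (a b : A), cmul a (l *: b) = l *: cmul a b;
  cadjK : involutive cadj;
  cadjD : {morph cadj : a b / a + b};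
  cadjZ : forall (l : R[i]) (a : A), cadj (l *: a) = l^* *: cadj a;
  cadjM : forall a b : A, cadj (cmul a b) = cmul (cadj b) (cadj a);
  cmul_norm : forall a b : A, `|cmul a b| <= `|a| * `|b|;
  cstar_id : forall a : A, `|cmul (cadj a) a| = `|a| ^+ 2
}.

#[short(type="cstarAlgType")]
HB.structure Definition CstarAlgebra (R : realType) :=
  {A of isCstarAlgebra R A & CompleteNormedModule R[i] A}.

Notation "a ** b" := (cmul a b) (at level 40, left associativity).

Section cstar_theory.
Context {R : realType} {B : cstarAlgType R}.
Implicit Types (A : set B) (a b p : B).

Record cstar_subalgebra A : Prop := CstarSubalgebra {
  cstar_sub0 : A 0;
  cstar_subD : forall a b, A a -> A b -> A (a + b);
  cstar_subZ : forall (l : R[i]) a, A a -> A (l *: a);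
  cstar_subM : forall a b, A a -> A b -> A (a ** b);
  cstar_sub_adj : forall a, A a -> A (cadj a);
  cstar_sub_closed : closed A
}.

(* The product of B x R[i], the algebra obtained from B by adjoining a unit;
   (a, l) stands for a + l1, and the unit is (0, 1). *)
Definition unitization_mul (x y : B * R[i]) : B * R[i] :=
  (x.1 ** y.1 + x.2 *: y.1 + y.2 *: x.1, x.2 * y.2).

(* The spectrum of a relative to the subalgebra A, i.e. the set of l such that
   l1 - a has no inverse in the algebra obtained by adjoining a unit to A. (If
   A has a unit of its own, this adds at most the point 0 to the spectrum in A,
   which does not affect positivity.) *)
Definition spectrum A a : set R[i] :=
  [set l | ~ exists y : B * R[i],
     [/\ A y.1, unitization_mul (- a, l) y = (0, 1)
       & unitization_mul y (- a, l) = (0, 1)]].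

Definition positive_part A : set B :=
  [set a | [/\ A a, cadj a = a & spectrum A a `<=` [set l | 0 <= l]]].

Definition is_projection p : Prop := p ** p = p /\ cadj p = p.

Definition hereditary_subalgebra a : set B :=
  closure [set a ** b ** a | b in [set: B]].

(* That A is a C*-subalgebra of B is part of the claim, not a presupposition. *)
Definition SP_inclusion A : Prop :=
  cstar_subalgebra A /\
  forall a, positive_part A a -> a <> 0 ->
    exists p, [/\ hereditary_subalgebra a p, is_projection p & p <> 0].

End cstar_theory.

Section complex_complete.
Context {R : realType}.
Implicit Types z : R[i].

Lemma Re_normc z : (complex.Re `|z|)%:C = `|z|.
Proof. by rewrite RRe_real// normr_real. Qed.

Lemma rcD (a b : R) : (a + b)%:C = a%:C + b%:C.
Proof. exact: rmorphD. Qed.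

Lemma rcM (a b : R) : (a * b)%:C = a%:C * b%:C.
Proof. exact: rmorphM. Qed.

Lemma rcX (a : R) n : (a ^+ n)%:C = a%:C ^+ n.
Proof. exact: rmorphXn. Qed.

Lemma le_normRe z : `|complex.Re z|%:C <= `|z|.
Proof.
case: z => a b; rewrite normc_def lecR /= -sqrtr_sqr ler_sqrt ?lerDl ?sqr_ge0//.
by rewrite addr_ge0// sqr_ge0.
Qed.

Lemma le_normIm z : `|complex.Im z|%:C <= `|z|.
Proof.
case: z => a b; rewrite normc_def lecR /= -sqrtr_sqr ler_sqrt ?lerDr ?sqr_ge0//.
by rewrite addr_ge0// sqr_ge0.
Qed.

Lemma normc_le_ReIm z : `|z| <= (`|complex.Re z| + `|complex.Im z|)%:C.
Proof.
rewrite normc_def lecR -[leRHS]ger0_norm ?addr_ge0// -sqrtr_sqr.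
rewrite ler_sqrt ?sqr_ge0// sqrrD !real_normK ?num_real// addrAC lerDl.
by rewrite mulrn_wge0// mulr_ge0.
Qed.

Lemma gt0_complex z : 0 < z -> exists2 e : R, 0 < e & z = e%:C.
Proof.
case: z => a b; rewrite ltcE /= => /andP[/eqP -> a0]; by exists a.
Qed.

Lemma complex_cauchy_cvg (F : set_system R[i]^o) :
  ProperFilter F -> cauchy F -> cvg F.
Proof.
move=> PF /cauchyP Fc.
have H (h : R[i] -> R) : (forall z w, `|h z - h w|%:C <= `|z - w|) ->
    exists l : R, (h : R[i]^o -> R) @ F --> l.
  move=> hl; apply/cvg_ex; apply: cauchy_cvg; apply: cauchy_exP => e e0.
  have [|z Fz] := Fc e%:C; first by rewrite ltcR.
  exists (h z); change (F [set w | ball (h z) e (h w)]).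
  apply: filterS Fz => w /=; rewrite -!ball_normE /= => zw; rewrite -ltcR.
  exact: le_lt_trans (hl _ _) zw.
have [|a Fa] := H (@complex.Re R).
  by move=> z w; rewrite -raddfB; apply: le_normRe.
have [|b Fb] := H (@complex.Im R).
  by move=> z w; rewrite -raddfB; apply: le_normIm.
apply/cvg_ex; exists (a +i* b : R[i]^o); apply/cvgrPdist_le => e /gt0_complex[d d0 ->].
have d2 : 0 < d / 2 by rewrite divr_gt0.
move/cvgrPdist_le: Fa => /(_ _ d2) Fa; move/cvgrPdist_le: Fb => /(_ _ d2) Fb.
near=> z.
apply: le_trans (normc_le_ReIm _) _; rewrite lecR (splitr d) lerD//.
- by rewrite raddfB/=; near: z.
- by rewrite raddfB/=; near: z.
Unshelve. all: by end_near. Qed.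

End complex_complete.

(* C(T) for compact T; the proof of compactness is a parameter of the type so
   that the supremum norm below is always finite. *)
Definition contfun (R : realType) (T : topologicalType)
  (cT : compact [set: T]) : Type := continuousType T R[i]^o.

Section contfun.
Context {R : realType} {T : topologicalType} (cT : compact [set: T]).
Local Notation CT := (contfun R cT).
Local Notation C := (R[i]^o).
Implicit Types f g h : CT.

HB.instance Definition _ := Choice.on CT.

Definition mkcontfun (h : T -> C) (hc : continuous h) : CT :=
  mkcts hc : continuousType T C.

Lemma contfunP f g : (f : T -> C) =1 g -> f = g.
Proof. by move=> fg; apply/continuousEP. Qed.

Lemma contfun_cts f : continuous (f : T -> C).
Proof. exact: cts_fun. Qed.

Lemma contfun_add_cts f g : continuous (fun x => f x + g x : C).
Proof. by move=> x; apply: cvgD; apply: contfun_cts. Qed.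

Lemma contfun_opp_cts f : continuous (fun x => - f x : C).
Proof. by move=> x; apply: cvgN; apply: contfun_cts. Qed.

Lemma contfun_mul_cts f g : continuous (fun x => f x * g x : C).
Proof. by move=> x; apply: cvgM; apply: contfun_cts. Qed.

Lemma contfun_conj_cts f : continuous (fun x => (f x)^* : C).
Proof.
move=> x; apply/cvgrPdist_lt => e e0.
have /cvgrPdist_lt/(_ _ e0) := @contfun_cts f x.
apply: filterS => y; rewrite -rmorphB/=.
by case: (f x - f y) => a b; rewrite !normc_def/= sqrrN.
Qed.

Definition contfun_add f g : CT := mkcontfun (@contfun_add_cts f g).
Definition contfun_opp f : CT := mkcontfun (@contfun_opp_cts f).
Definition contfun_cst (l : C) : CT := mkcontfun (@cst_continuous T C l).
Definition contfun_mul f g : CT := mkcontfun (@contfun_mul_cts f g).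
Definition contfun_scale (l : R[i]) f : CT := contfun_mul (contfun_cst l) f.
Definition contfun_adj f : CT := mkcontfun (@contfun_conj_cts f).

Lemma contfun_addA : associative contfun_add.
Proof. by move=> f g h; apply: contfunP => x; apply: addrA. Qed.
Lemma contfun_addC : commutative contfun_add.
Proof. by move=> f g; apply: contfunP => x; apply: addrC. Qed.
Lemma contfun_add0 : left_id (contfun_cst 0) contfun_add.
Proof. by move=> f; apply: contfunP => x; apply: add0r. Qed.
Lemma contfun_addN : left_inverse (contfun_cst 0) contfun_opp contfun_add.
Proof. by move=> f; apply: contfunP => x; apply: addNr. Qed.

HB.instance Definition _ := GRing.isZmodule.Build CT
  contfun_addA contfun_addC contfun_add0 contfun_addN.

Lemma contfun_scaleA l m f :
  contfun_scale l (contfun_scale m f) = contfun_scale (l * m) f.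
Proof. by apply: contfunP => x; apply: mulrA. Qed.
Lemma contfun_scale1 : left_id 1 contfun_scale.
Proof. by move=> f; apply: contfunP => x; apply: mul1r. Qed.
Lemma contfun_scaleDr : right_distributive contfun_scale +%R.
Proof. by move=> l f g; apply: contfunP => x; apply: mulrDr. Qed.
Lemma contfun_scaleDl f : {morph contfun_scale^~ f : l m / l + m}.
Proof. by move=> l m; apply: contfunP => x; apply: mulrDl. Qed.

HB.instance Definition _ := GRing.Zmodule_isLmodule.Build R[i] CT
  contfun_scaleA contfun_scale1 contfun_scaleDr contfun_scaleDl.

Definition supnorm f : R := sup [set complex.Re `|f x| | x in [set: T]].

Lemma supnorm_has_ub f : has_ubound [set complex.Re `|f x| | x in [set: T]].
Proof.
have cf : continuous (fun x => complex.Re `|f x| : R^o).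
  move=> x; apply/cvgrPdist_lt => e e0.
  have e0' : 0 < e%:C by rewrite ltcR.
  have /cvgrPdist_lt/(_ _ e0') := @contfun_cts f x.
  apply: filterS => y; rewrite -ltcR; apply: le_lt_trans.
  rewrite -raddfB; apply: le_trans (le_normRe _) _.
  exact: ler_dist_dist.
have /compact_bounded := continuous_compact (continuous_subspaceT cf) cT.
move=> [M [Mr HM]]; exists (M + 1) => _ [x _ <-].
apply: le_trans (ler_norm _) _; apply: (HM (M + 1)); last by exists x.
by rewrite ltrDl.
Qed.

Lemma supnorm_ub f x : `|f x| <= (supnorm f)%:C.
Proof.
rewrite -Re_normc lecR; apply: ub_le_sup; first exact: supnorm_has_ub.
by exists x.
Qed.

Lemma supnorm_le f (r : R) :
  0 <= r -> (forall x, `|f x| <= r%:C) -> supnorm f <= r.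
Proof.
move=> r0 fr; rewrite /supnorm.
set S := [set _ | _ in _]; have [->|/set0P S0] := eqVneq S set0.
  by rewrite sup0.
by apply: ge_sup => // _ [x _ <-]; rewrite -lecR Re_normc.
Qed.

Lemma supnorm_ge0 f : 0 <= supnorm f.
Proof.
rewrite /supnorm; set S := [set _ | _ in _].
have [->|/set0P[_ [x _ _]]] := eqVneq S set0; first by rewrite sup0.
by rewrite -lecR; apply: le_trans (supnorm_ub f x).
Qed.

Lemma supnormD f g : (supnorm (f + g))%:C <= (supnorm f)%:C + (supnorm g)%:C.
Proof.
rewrite -rcD lecR supnorm_le// ?addr_ge0 ?supnorm_ge0// => x.
by rewrite rcD; apply: le_trans (ler_normD _ _) _; rewrite lerD ?supnorm_ub.
Qed.

Lemma supnormM_le f g : supnorm (contfun_mul f g) <= supnorm f * supnorm g.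
Proof.
rewrite supnorm_le// ?mulr_ge0 ?supnorm_ge0// => x.
by rewrite normrM rcM ler_pM ?supnorm_ub.
Qed.

Lemma supnormZ (l : R[i]) f : (supnorm (l *: f))%:C = `|l| * (supnorm f)%:C.
Proof.
apply/eqP; rewrite eq_le; apply/andP; split.
  rewrite -[`|l|]Re_normc -rcM lecR supnorm_le//.
    by rewrite mulr_ge0 ?supnorm_ge0// -ler0c Re_normc.
  by move=> x; rewrite rcM Re_normc normrM ler_pM ?supnorm_ub.
have [->|l0] := eqVneq l 0; first by rewrite normr0 mul0r ler0c supnorm_ge0.
rewrite -ler_pdivlMl ?normr_gt0// -normfV -[`|l^-1|]Re_normc -rcM lecR.
rewrite supnorm_le//.
  by rewrite mulr_ge0 ?supnorm_ge0// -ler0c Re_normc.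
move=> x; rewrite rcM Re_normc.
rewrite -[leLHS](_ : `|l^-1 * (l * f x)| = _); last by rewrite mulKf.
by rewrite normrM ler_pM// (supnorm_ub (l *: f)).
Qed.

Lemma supnorm_eq0 f : (supnorm f)%:C = 0 -> f = 0.
Proof.
move=> f0; apply: contfunP => x; apply/eqP; rewrite -normr_le0 -f0.
exact: supnorm_ub.
Qed.

HB.instance Definition _ := Lmodule_isNormed.Build R[i] CT
  supnormD supnormZ supnorm_eq0.

Lemma contfun_normE f : `|f| = (supnorm f)%:C.
Proof. by []. Qed.

Lemma contfun_cauchy_cvg (F : set_system CT) :
  ProperFilter F -> cauchy F -> cvg F.
Proof.
move=> PF /cauchyP Fc.
have ev f g x : `|f x - g x| <= `|f - g|.
  exact: supnorm_ub (f - g) x.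
have H x : exists l : C, (fun f : CT => f x : C) @ F --> l.
  apply/cvg_ex; apply: complex_cauchy_cvg; apply: cauchy_exP => e e0.
  have [f Ff] := Fc e e0; exists (f x).
  change (F [set g : CT | ball (f x : C) e (g x)]).
  apply: filterS Ff => g; rewrite -!ball_normE /=.
  exact: le_lt_trans (ev _ _ _).
have [g Fg] := choice H.
have approx (e : R[i]) : 0 < e -> exists2 f : CT,
    F [set h : CT | `|f - h| < e] & forall x, `|f x - g x| <= e + e.
  move=> e0; have [f Ff] := Fc e e0; exists f.
    by apply: filterS Ff => h; rewrite -ball_normE.
  move=> x; have /cvgrPdist_lt/(_ _ e0) Fgx := Fg x.
  have [h [fh gh]] := filter_ex (filterI Ff Fgx).
  have {}fh : `|f x - h x| <= e.
    apply: le_trans (ev _ _ _) _; apply: ltW.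
    by move: fh; rewrite -ball_normE.
  rewrite -(subrKA (h x)); apply: le_trans (ler_normD _ _) _.
  by rewrite lerD// distrC ltW.
have cg : continuous g.
  move=> x; apply/cvgrPdist_le => e e0.
  have d0 : 0 < e / 5 by rewrite divr_gt0.
  have [f _ fg] := approx _ d0.
  have /cvgrPdist_lt/(_ _ d0) := @contfun_cts f x.
  apply: filterS => y fxy.
  rewrite -(subrKA (f x)) -[X in _ + X](subrKA (f y)).
  rewrite [leRHS](_ : _ = (e / 5 + e / 5) + (e / 5 + (e / 5 + e / 5))); last first.
    by field.
  apply: le_trans (ler_normD _ _) _; rewrite lerD//; first by rewrite distrC.
  by apply: le_trans (ler_normD _ _) _; rewrite lerD// ltW.
apply/cvg_ex; exists (mkcontfun cg); apply/(cvgrPdist_le id) => e e0.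
have d0 : 0 < e / 3 by rewrite divr_gt0.
have [f Ff fg] := approx _ d0.
apply: filterS Ff => h fh.
have [e' e'0 ee'] := gt0_complex e0; rewrite ee' contfun_normE lecR.
apply: supnorm_le => [|x]; first exact: ltW.
rewrite -ee' -[leLHS]/(`|g x - h x|) -(subrKA (f x)).
rewrite [leRHS](_ : _ = (e / 3 + e / 3) + e / 3); last by field.
apply: le_trans (ler_normD _ _) _; rewrite lerD//; first by rewrite distrC.
by apply: le_trans (ev _ _ _) _; apply: ltW.
Qed.

HB.instance Definition _ := Uniform_isComplete.Build CT contfun_cauchy_cvg.

Lemma contfun_mulA : associative contfun_mul.
Proof. by move=> f g h; apply: contfunP => x; apply: mulrA. Qed.
Lemma contfun_mulDl : left_distributive contfun_mul +%R.
Proof. by move=> f g h; apply: contfunP => x; apply: mulrDl. Qed.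
Lemma contfun_mulDr : right_distributive contfun_mul +%R.
Proof. by move=> f g h; apply: contfunP => x; apply: mulrDr. Qed.
Lemma contfun_mulZl (l : R[i]) f g :
  contfun_mul (l *: f) g = l *: contfun_mul f g.
Proof. by apply: contfunP => x; apply: (esym (mulrA _ _ _)). Qed.
Lemma contfun_mulZr (l : R[i]) f g :
  contfun_mul f (l *: g) = l *: contfun_mul f g.
Proof. by apply: contfunP => x; apply: mulrCA. Qed.
Lemma contfun_adjK : involutive contfun_adj.
Proof. by move=> f; apply: contfunP => x; apply: conjcK. Qed.
Lemma contfun_adjD : {morph contfun_adj : f g / f + g}.
Proof. by move=> f g; apply: contfunP => x; apply: rmorphD. Qed.
Lemma contfun_adjZ (l : R[i]) f : contfun_adj (l *: f) = l^* *: contfun_adj f.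
Proof. by apply: contfunP => x; apply: rmorphM. Qed.
Lemma contfun_adjM f g :
  contfun_adj (contfun_mul f g) = contfun_mul (contfun_adj g) (contfun_adj f).
Proof.
apply: contfunP => x.
by apply: (etrans (rmorphM (@conjc R) (f x) (g x))); apply: mulrC.
Qed.
Lemma contfun_normM f g : `|contfun_mul f g| <= `|f| * `|g|.
Proof. by rewrite !contfun_normE -rcM lecR supnormM_le. Qed.

Lemma conjc_norm (z : R[i]) : `|z^*| = `|z|.
Proof. by case: z => a b; rewrite !normc_def/= sqrrN. Qed.

Lemma contfun_cstar f : `|contfun_mul (contfun_adj f) f| = `|f| ^+ 2.
Proof.
rewrite !contfun_normE -rcX; congr (_%:C); apply/eqP; rewrite eq_le.
apply/andP; split.
  rewrite supnorm_le ?exprn_ge0 ?supnorm_ge0// => x.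
  rewrite normrM conjc_norm rcX -expr2.
  by rewrite lerXn2r ?nnegrE// ?supnorm_ub// ler0c supnorm_ge0.
rewrite -[leRHS]sqr_sqrtr ?supnorm_ge0// lerXn2r ?nnegrE ?sqrtr_ge0 ?supnorm_ge0//.
apply: supnorm_le; first exact: sqrtr_ge0.
move=> x; rewrite -(@ler_pXn2r _ 2) ?nnegrE//; last by rewrite ler0c sqrtr_ge0.
rewrite -[leRHS]rcX sqr_sqrtr ?supnorm_ge0// expr2 -{1}conjc_norm -normrM.
exact: (supnorm_ub (contfun_mul (contfun_adj f) f)).
Qed.

HB.instance Definition _ := isCstarAlgebra.Build R CT
  contfun_mulA contfun_mulDl contfun_mulDr contfun_mulZl contfun_mulZr
  contfun_adjK contfun_adjD contfun_adjZ contfun_adjM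
  contfun_normM contfun_cstar.

End contfun.

Definition pullback (R : realType) (X Y : topologicalType)
    (cX : compact [set: X]) (cY : compact [set: Y]) (Phi : continuousType Y X)
    (g : contfun R cX) : contfun R cY :=
  (g : continuousType X R[i]^o) \o Phi : continuousType Y R[i]^o.

(* Main.v *)
Require Import Defs.
From mathcomp Require Import all_boot all_order all_algebra.
From mathcomp Require Import all_classical all_reals all_analysis.
From mathcomp Require Import complex ring.

Import Order.TTheory GRing.Theory Num.Theory.
Import numFieldNormedType.Exports.

Local Open Scope classical_set_scope.

(** In the commutative algebra C(Y) everything can be read off pointwise:
    projections are the indicators of clopen sets, and every function in the
    hereditary subalgebra of [a] vanishes wherever [a] does.

    If the inclusion is SP and [U] is a nonempty open subset of [X], Urysohn's
    lemma gives a nonzero [g >= 0] on [X] vanishing off [U] ([urysohn_bump]).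
    Its pullback is positive in the subalgebra ([positive_part_pullback]) and
    nonzero because [Phi] is onto, so its hereditary subalgebra contains a
    nonzero projection [p].  The support of [p] is clopen, hence compact, and it
    lies over [U] since [p] vanishes wherever [g \o Phi] does.

    Conversely, let [a = g \o Phi] be nonzero, and let [V] be a nonempty compact
    open set lying over the open set where [g] is nonzero.  As [Y] is Hausdorff,
    [V] is clopen, so [1_V / a ^ 2], extended by zero, is continuous; multiplying
    it on both sides by [a] yields the projection [1_V]
    ([hereditary_clopen_indicator]).

    That the range of the pullback is a C*-subalgebra at all follows from its
    description as the set of functions constant on the fibres of [Phi]
    ([range_pullbackE]). *)

(** * Continuity *)

Section continuity.
Local Open Scope ring_scope.
Local Open Scope complex_scope.

(** Around each point the patched function agrees with either [h] or the constant
    [d], according to which of the two open sets [V] and [~` V] the point is in.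
    Continuity of [h] on [V] suffices, which allows quotients whose denominators
    vanish outside [V]. *)
Lemma clopen_patch_continuous (T U : topologicalType) (d : U) (V : set T)
    (h : T -> U) :
  open V -> closed V -> (forall x, V x -> {for x, continuous h}) ->
  continuous (patch (cst d) V h).
Proof.
move=> oV cV ch x; have [Vx|nVx] := pselect (V x).
  have nV : nbhs x V by apply: open_nbhs_nbhs.
  rewrite /continuous_at {2}/patch mem_set//.
  move=> W /(ch x Vx) hW; apply: filterS (filterI nV hW) => y [Vy Wy] /=.
  by rewrite /patch mem_set.
apply: (@near_cst_continuous _ _ d).
have : nbhs x (~` V) by apply: open_nbhs_nbhs; split=> //; exact: closed_openC.
by apply: filterS => y nVy; rewrite /patch memNset.
Qed.

Lemma real_complex_continuous (R : realType) (T : topologicalType) (f : T -> R) :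
  continuous f -> continuous (fun x => (f x)%:C : R[i]^o).
Proof.
move=> cf x; apply/cvgrPdist_lt => _ /gt0_complex[e e0 ->].
have /cvgrPdist_lt/(_ _ e0) := cf x.
by apply: filterS => y; rewrite -rmorphB /= normc_def /= expr0n addr0 sqrtr_sqr ltcR.
Qed.

Lemma closed_complex_set1 (R : realType) (z : R[i]^o) : closed [set z].
Proof. exact/accessible_closed_set1/hausdorff_accessible/norm_hausdorff. Qed.

Lemma continuous_complex_inv (R : realType) (T : topologicalType)
    (f : T -> R[i]^o) (x : T) :
  {for x, continuous f} -> f x != 0 ->
  {for x, continuous (fun y => (f y)^-1 : R[i]^o)}.
Proof. by move=> cf fx0; apply: cvgV. Qed.

End continuity.

(** * Projections and hereditary subalgebras of C(T) *)

Section contfun_theory.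
Local Open Scope ring_scope.
Local Open Scope complex_scope.
Context (R : realType) (T : topologicalType) (cT : compact [set: T]).
Local Notation CT := (contfun R cT).

(** Evaluation is contractive for the supremum norm. *)
Lemma contfun_eval_continuous (x : T) : continuous (fun f : CT => f x : R[i]^o).
Proof.
move=> f; apply/(@cvgrPdist_lt _ _ _ _ (nbhs_filter f)) => e e0.
apply: filterS (nbhsx_ballx f e e0) => g; rewrite -ball_normE.
by apply: le_lt_trans; exact: supnorm_ub (f - g) x.
Qed.

Lemma closed_contfun_eq (x y : T) : closed [set f : CT | f x = f y].
Proof.
have /continuous_closedP cE : continuous (fun f : CT => f x - f y : R[i]^o).
  move=> f; exact: (@cvgB _ _ _ _ (nbhs_filter f) _ _ _ _
    (contfun_eval_continuous x f) (contfun_eval_continuous y f)).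
rewrite [X in closed X](_ : _ = (fun f : CT => f x - f y : R[i]^o) @^-1` [set 0]).
  by apply: cE; apply: closed_complex_set1.
apply/seteqP; split=> f /=; first by move=> ->; rewrite subrr.
by move/eqP; rewrite subr_eq0 => /eqP.
Qed.

Lemma closed_contfun_zeros (x : T) : closed [set f : CT | f x = 0].
Proof.
have /continuous_closedP cE := contfun_eval_continuous x.
by apply: (cE [set 0]); apply: closed_complex_set1.
Qed.

(** Every [a b a] vanishes at the zeros of [a], and vanishing at a given point is
    preserved by norm limits. *)
Lemma hereditary_vanish (a : CT) (f : CT) (x : T) :
  hereditary_subalgebra a f -> a x = 0 -> f x = 0.
Proof.
move=> af ax0; apply: (closed_contfun_zeros x).
apply: closureS af => _ [b _ <-] /=.
have -> : (a ** b ** a : CT) x = a x * b x * a x by [].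
by rewrite ax0 mulr0.
Qed.

Lemma projection_val (p : CT) (x : T) : is_projection p -> p x = 0 \/ p x = 1.
Proof.
case=> /(congr1 (fun f : CT => f x)) pp _.
have {pp} : p x * (p x - 1) = 0.
  by rewrite mulrBr mulr1 -[X in X - _]/((p ** p : CT) x) pp subrr.
by move/eqP; rewrite mulf_eq0 subr_eq0 => /orP[]/eqP; [left|right].
Qed.

(** A projection takes only the values 0 and 1, so its support is both the
    preimage of the open set of nonzero scalars and that of the closed set {1}. *)
Lemma projection_support_clopen (p : CT) :
  is_projection p -> open [set x | p x != 0] /\ closed [set x | p x != 0].
Proof.
move=> pP; have /continuous_closedP cp := @contfun_cts _ _ _ p.
split.
  rewrite (_ : [set _ | _] = ~` (p @^-1` [set 0])); last first.
    by apply/seteqP; split=> x /= /eqP.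
  by apply: closed_openC; apply: cp; apply: closed_complex_set1.
rewrite (_ : [set _ | _] = p @^-1` [set 1]); last first.
  apply/seteqP; split=> x /=; last by move=> ->; exact: oner_neq0.
  by case: (projection_val p x pP) => ->; rewrite ?eqxx.
by apply: cp; apply: closed_complex_set1.
Qed.

Lemma urysohn_bump (hT : hausdorff_space T) (U : set T) (x0 : T) :
  open U -> U x0 ->
  exists g : CT,
    [/\ g x0 = 1, forall x, ~ U x -> g x = 0 & forall x, 0 <= g x].
Proof.
move=> oU Ux0.
have /(@normal_separatorP R T) sep := compact_normal hT cT.
have /(@uniform_separatorP _ R)[f [cf f01 f0 f1]] :
    uniform_separator (~` U) [set x0].
  apply: sep; first exact: open_closedC.
    exact/accessible_closed_set1/hausdorff_accessible.
  by apply/seteqP; split=> // x [+ xx0]; rewrite xx0 => nUx; case: nUx.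
exists (mkcontfun cT (real_complex_continuous _ _ f cf)); split=> [|x nUx|x] /=.
- by rewrite -[LHS]/((f x0)%:C) (f1 (f x0))//; exists x0.
- by rewrite -[LHS]/((f x)%:C) (f0 (f x))//; exists x.
- have /f01 : range f (f x) by exists x.
  by rewrite /= in_itv /= => /andP[]; rewrite -lecR.
Qed.

(** The indicator of [V] is exactly [a b a] with [b = 1_V / a ^ 2]: no limit is
    involved, although the hereditary subalgebra is defined as a closure. *)
Lemma hereditary_clopen_indicator (a : CT) (V : set T) :
  open V -> closed V -> V !=set0 -> (forall x, V x -> a x != 0) ->
  exists p : CT, [/\ hereditary_subalgebra a p, is_projection p & p <> 0].
Proof.
move=> oV cV [x0 Vx0] aV.
pose p := mkcontfun cT (clopen_patch_continuous _ _ (0 : R[i]^o) _ (cst 1) oV cV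
  (fun x _ => @cst_continuous T R[i]^o 1 x)).
have cinv (x : T) : V x -> {for x, continuous (fun y => (a y * a y)^-1 : R[i]^o)}.
  move=> Vx; apply: continuous_complex_inv; last by rewrite mulf_neq0 ?aV.
  exact: (@contfun_cts _ _ _ (contfun_mul a a)).
pose b := mkcontfun cT (clopen_patch_continuous _ _ (0 : R[i]^o) _ _ oV cV cinv).
have pE x : p x = if x \in V then 1 else 0 by [].
have bE x : b x = if x \in V then (a x * a x)^-1 else 0 by [].
exists p; split.
- apply: subset_closure; exists b => //; apply: contfunP => x.
  rewrite -[LHS]/(a x * b x * a x) bE pE; case: ifPn => [/set_mem Vx|_].
    by rewrite mulrAC divff// mulf_neq0 ?aV.
  by rewrite mulr0 mul0r.
- split; apply: contfunP => x.
    by rewrite -[LHS]/(p x * p x) pE; case: ifP => _; rewrite ?mulr1 ?mulr0.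
  by rewrite -[LHS]/((p x)^*) pE; case: ifP => _; rewrite ?rmorph1 ?rmorph0.
- move/(congr1 (fun f : CT => f x0)); rewrite pE mem_set// => /eqP.
  by rewrite -[X in _ == X]/(0 : R[i]) oner_eq0.
Qed.

End contfun_theory.

(** * The subalgebra of pulled back functions *)

Section pullback_theory.
Local Open Scope ring_scope.
Local Open Scope complex_scope.
Context (R : realType) (X Y : topologicalType).
Context (cX : compact [set: X]) (hX : hausdorff_space X).
Context (cY : compact [set: Y]) (Phi : continuousType Y X).
Context (surjPhi : set_surj [set: Y] [set: X] Phi).
Local Notation A := (range (@pullback R X Y cX cY Phi)).

(** A function constant on the fibres descends to a function on [X], obtained by
    composing with any section of [Phi].  The descended function is continuous
    because [Phi] is a closed map: images of closed subsets of [Y] are compact,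
    hence closed in the Hausdorff space [X]. *)
Lemma range_pullbackE :
  A = [set f : contfun R cY | forall y z, Phi y = Phi z -> f y = f z].
Proof.
apply/seteqP; split=> [_ [g _ <-] y z yz|f fP].
  by rewrite -[LHS]/(g (Phi y)) yz.
have /choice[s sK] : forall x, exists y, Phi y = x.
  by move=> x; have [y _ <-] := surjPhi x I; exists y.
have fs y : f (s (Phi y)) = f y by apply: fP; rewrite sK.
have cs : continuous (fun x => f (s x) : R[i]^o).
  apply/continuous_closedP => C cC.
  have -> : (fun x => f (s x)) @^-1` C = Phi @` (f @^-1` C).
    apply/seteqP; split=> [x Cx|_ [y Cy <-]] /=; last by rewrite fs.
    by exists (s x).
  apply: compact_closed hX _; apply: continuous_compact.
    exact/continuous_subspaceT/cts_fun.
  apply: (subclosed_compact _ cY) => //.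
  by have /continuous_closedP := @contfun_cts _ _ _ f; apply.
by exists (mkcontfun cX cs) => //; apply: contfunP => y; apply: fs.
Qed.

(** Being constant on fibres is preserved by the pointwise operations, and it is a
    conjunction of the closed conditions [f y = f z]. *)
Lemma cstar_subalgebra_range_pullback : cstar_subalgebra A.
Proof.
rewrite range_pullbackE; split.
- by [].
- by move=> a b aP bP y z yz; apply: (congr2 +%R); [apply: aP|apply: bP].
- by move=> l a aP y z yz; apply: (congr1 ( *%R l)); apply: aP.
- by move=> a b aP bP y z yz; apply: (congr2 *%R); [apply: aP|apply: bP].
- by move=> a aP y z yz; apply: (congr1 (@conjc R)); apply: aP.
- rewrite (_ : [set _ | _] = \bigcap_(yz in [set yz : Y * Y | Phi yz.1 = Phi yz.2])
      [set f : contfun R cY | f yz.1 = f yz.2]).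
    by apply: closed_bigI => yz _; apply: closed_contfun_eq.
  apply/seteqP; split=> [f fP [y z] /= /fP//|f fP y z yz].
  exact: (fP (y, z)).
Qed.

(** For [l] not a nonnegative real, [l - g] never vanishes; its inverse is a
    continuous function on [X], so pulling back provides the resolvent of
    [g \o Phi] inside the subalgebra. *)
Lemma positive_part_pullback (g : contfun R cX) :
  (forall x, 0 <= g x) -> positive_part A (pullback cY Phi g).
Proof.
move=> g0; split; first by exists g.
  apply: contfunP => y; apply: (CrealP (ger0_real (g0 (Phi y)))).
move=> l nl /=; apply: contrapT => l0; apply: nl.
have lN0 : l != 0 by apply: contra_notN l0 => /eqP ->.
have lg x : l - g x != 0.
  by rewrite subr_eq0; apply: contra_notN l0 => /eqP ->.
(* [h] is the non-scalar part of the inverse in the unitization: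
   1 / (l - g) = 1 / l + h, where the scalar component must be 1 / l. *)
have ch : continuous (fun x => g x / (l * (l - g x)) : R[i]^o).
  move=> x; apply: cvgM; first exact: contfun_cts.
  apply: continuous_complex_inv; last by rewrite mulf_neq0.
  by apply: cvgM; [exact: cvg_cst|apply: cvgB; [exact: cvg_cst|exact: contfun_cts]].
pose h := mkcontfun cX ch.
have key x : - g x * h x + l * h x + l^-1 * - g x = 0.
  rewrite -[h x]/(g x / (l * (l - g x))); field.
  by rewrite lN0 lg.
exists (pullback cY Phi h, l^-1); split; first by exists h.
- congr pair; last exact: divff.
  by apply: contfunP => y; apply: key.
- congr pair; last exact: mulVf.
  apply: contfunP => y; rewrite -[RHS](key (Phi y)).
  by rewrite [- g _ * _]mulrC addrAC.
Qed.

End pullback_theory.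

Theorem proposition2p16 (R : realType) (X Y : topologicalType)
    (cX : compact [set: X]) (hX : hausdorff_space X)
    (cY : compact [set: Y]) (hY : hausdorff_space Y)
    (Phi : continuousType Y X) (surjPhi : set_surj [set: Y] [set: X] Phi) :
  SP_inclusion (range (@pullback R X Y cX cY Phi)) <->
  (forall U : set X, open U -> U !=set0 ->
     exists V : set Y,
       [/\ V `<=` Phi @^-1` U, V !=set0, compact V & open V]).
Proof.
split=> [[_ SP] U oU [x0 Ux0]|H].
  have [g [gx0 gU g0]] := urysohn_bump R X cX hX U x0 oU Ux0.
  have [y0 _ Phiy0] := surjPhi x0 I.
  have [|p [ap pP p0]] := SP _ (positive_part_pullback R X Y cX cY Phi g g0).
    move/(congr1 (fun f : contfun R cY => f y0)).
    rewrite -[LHS]/(g (Phi y0)) Phiy0 gx0 => /eqP.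
    by rewrite -[X in _ == X]/(0%R : R[i]) oner_eq0.
  have [op clp] := projection_support_clopen R Y cY p pP.
  exists [set y | p y != 0%R]; split=> //.
  - move=> y /= /eqP py; apply: contrapT => /gU gy.
    by apply: py; apply: (hereditary_vanish R Y cY _ p y ap).
  - apply/set0P/eqP => supp0; apply: p0; apply: contfunP => y.
    apply/eqP/negPn/negP => py.
    by have : [set y | p y != 0%R] y by []; rewrite supp0.
  - exact: subclosed_compact clp cY (@subsetT _ _).
split; first exact: cstar_subalgebra_range_pullback.
move=> _ [[g _ <-] _ _] a0.
have U0 : [set x | g x != 0%R] !=set0.
  apply: contrapT => nU; apply: a0; apply: contfunP => y.
  by apply/eqP/negPn/negP => gy; apply: nU; exists (Phi y).
have oU : open [set x | g x != 0%R].
  rewrite (_ : [set _ | _] = g @^-1` (~` [set 0%R])); last first.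
    by apply/seteqP; split=> x /= /eqP.
  have /continuousP := @contfun_cts _ _ _ g; apply; apply: closed_openC.
  exact: closed_complex_set1.
have [V [VU V0 cV oV]] := H _ oU U0.
apply: (hereditary_clopen_indicator R Y cY _ V) => //.
exact: compact_closed hY cV.
Qed.
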